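(* Let $p>3$ be a prime number and let $i,k,y\in\mathbb F_p$ with $y\neq 0$. Let $A=A_{i,k,y}$ be the brace constructed in the context. Then $A$ is a prime brace. Moreover, $A$ contains a non-zero strongly nilpotent (i.e. both right and left nilpotent) ideal, namely $A^2$.
   Context: A (left) brace is a set $A$ with operations $+,\circ$ such that $(A,+)$ is an abelian group, $(A,\circ)$ is a group, and $a\circ(b+c)+a=a\circ b+a\circ c$ for all $a,b,c\in A$. Put $a*b=a\circ b-a-b$, $\lambda_a(b)=a*b+b$. For subsets $X,Y$, $X*Y$ is the set of sums of elements $x*y$, $x\in X$, $y\in Y$. Put $A^1=A^{(1)}=A^{[1]}=A$, $A^{n+1}=A*A^n$, $A^{(n+1)}=A^{(n)}*A$, $A^{[n+1]}=\sum_{j=1}^{n}A^{[j]}*A^{[n+1-j]}$. A brace is left nilpotent, right nilpotent, strongly nilpotent if $A^n=0$, $A^{(n)}=0$, $A^{[n]}=0$ for some $n$, respectively (applied to an ideal regarded as a brace). An ideal of $A$ is an additive subgroup $I$ with $\lambda_a(I)\subseteq I$ for all $a\in A$ which is normal in $(A,\circ)$ (equivalently $A*I\subseteq I$ and $I*A\subseteq I$). A brace is prime if the product $I*J$ of any two non-zero ideals is non-zero. Group XV is the group $(G,\circ)$ of order $p^4$ generated by $P,Q,R,S$ subject to the relations $Q\circ S=S\circ Q\circ P$, $Q\circ R=R\circ Q$, $P\circ S=S\circ P$, $P\circ Q=Q\circ P$, $P\circ R=R\circ P$, $R\circ S=S\circ R\circ Q$, $P^p=Q^p=R^p=S^p=1_G$.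 Construction of $A_{i,k,y}$. Let $B'$ be the $\mathbb F_p$-vector space with basis $\mathbf 1,R',Q',P',S'$ and $B=\mathbb F_pP'+\mathbb F_pQ'+\mathbb F_pR'+\mathbb F_pS'\subset B'$. Define linear maps $\lambda_P,\lambda_Q,\lambda_R,\lambda_S:B'\to B'$ by $\lambda_g(\mathbf 1)=g'+\mathbf 1$ for $g\in\{P,Q,R,S\}$ and - $\lambda_P(P')=P'$, $\lambda_P(Q')=Q'$, $\lambda_P(R')=R'+yS'$, $\lambda_P(S')=S'$; - $\lambda_Q(P')=P'$, $\lambda_Q(Q')=Q'-yS'$, $\lambda_Q(R')=R'+2^{-1}yS'$, $\lambda_Q(S')=S'$; - $\lambda_R(P')=P'+yS'$, $\lambda_R(Q')=Q'+2^{-1}yS'$, $\lambda_R(R')=R'+iP'+kS'$, $\lambda_R(S')=S'$; - $\lambda_S(P')=P'$, $\lambda_S(Q')=Q'-P'$, $\lambda_S(R')=R'-Q'+P'-2^{-1}yS'$, $\lambda_S(S')=S'$. These maps satisfy the defining relations of $G$, so they extend to automorphisms $\lambda_g$ of $B'$ for all $g\in G$ with $\lambda_{g\circ h}=\lambda_g\lambda_h$. The map $f:G\to B$, $f(g)=\lambda_g(\mathbf 1)-\mathbf 1$, is a bijection. The brace $A_{i,k,y}$ is $(G,+,\circ)$, where $\circ$ is the group operation of $G$ and $g+h=f^{-1}(f(g)+f(h))$. *)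

(* Defs.v *)
From HB Require Import structures.
From mathcomp Require Import all_boot all_order all_fingroup all_algebra.
From mathcomp Require Import classical_sets.
From mathcomp Require Import zify ring.

Set Implicit Arguments.
Unset Strict Implicit.
Unset Printing Implicit Defensive.

Import GRing.Theory.
Local Open Scope classical_set_scope.
Local Open Scope ring_scope.

(* A left brace: the abelian group [+] is the [zmodType] structure, and the   *)
(* group operation "circle" is the multiplication [%g] of the [groupType].    *)
HB.mixin Record isBrace A & GRing.Zmodule A & monoid.Group A := {
  brace_distr : forall a b c : A, (a * (b + c))%g + a = (a * b)%g + (a * c)%g
}.

#[short(type="braceType")]
HB.structure Definition Brace := {A of isBrace A & GRing.Zmodule A & monoid.Group A}.

Section BraceTheory.
Variable A : braceType.
Implicit Types (a b x y : A) (X Y I J : set A).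

Definition star a b : A := (a * b)%g - a - b.
Definition blambda a b : A := star a b + b.

(* The set of all finite sums of elements [star x y] with [x] in [X] and [y]  *)
(* in [Y].                                                                    *)
Definition star_set X Y : set A :=
  [set z | exists2 s : seq (A * A),
     (forall u, u \in s -> X u.1 /\ Y u.2) & z = \sum_(u <- s) star u.1 u.2].

(* For an ideal [I], the set [I] with the operations of [A] is a brace, with  *)
(* the same star operation; its powers are therefore computed inside [A].     *)
(* Each of the three powers below is [I] at the exponents 0 and 1.            *)
Definition left_pow I n : set A := iter n.-1 (fun X => star_set I X) I.
Definition right_pow I n : set A := iter n.-1 (fun X => star_set X I) I.

Definition sum_sets n (X : nat -> set A) : set A :=
  [set z | exists2 x : nat -> A,
     (forall j, (1 <= j <= n)%N -> X j (x j)) & z = \sum_(1 <= j < n.+1) x j].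

(* [strong_pows I n] is the list of the powers of exponents 1, ..., n, which  *)
(* turns the course-of-values recursion into a structural one; the recursion  *)
(* itself is [strong_powS] below.                                             *)
Fixpoint strong_pows I n : seq (set A) :=
  if n isn't m.+1 then [::] else
  let s := strong_pows I m in
  rcons s (if m == 0%N then I else
    sum_sets m (fun j => star_set (nth I s j.-1) (nth I s (m.+1 - j).-1))).

Definition strong_pow I n : set A := nth I (strong_pows I n) n.-1.

Lemma size_strong_pows I n : size (strong_pows I n) = n.
Proof. by elim: n => //= n IHn; rewrite size_rcons IHn. Qed.

Lemma nth_strong_pows I m n :
  (m < n)%N -> nth I (strong_pows I n) m = strong_pow I m.+1.
Proof.
elim: n => // n IHn; rewrite ltnS leq_eqVlt => /predU1P[-> //|mn].
by rewrite -IHn //= nth_rcons size_strong_pows mn.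
Qed.

Lemma strong_pow1 I : strong_pow I 1 = I.
Proof. by []. Qed.

Lemma eq_sum_sets n (X Y : nat -> set A) :
  (forall j, (1 <= j <= n)%N -> X j = Y j) -> sum_sets n X = sum_sets n Y.
Proof.
move=> eqXY; apply/seteqP; split=> z [x Xx ->]; exists x => // j jn.
  by rewrite -eqXY //; exact: Xx.
by rewrite eqXY //; exact: Xx.
Qed.

Lemma strong_powS I n : (0 < n)%N ->
  strong_pow I n.+1 = sum_sets n
    (fun j => star_set (strong_pow I j) (strong_pow I (n.+1 - j))).
Proof.
case: n => // n _.
rewrite {1}/strong_pow -[n.+2.-1]/n.+1.
have -> : strong_pows I n.+2 = rcons (strong_pows I n.+1)
    (sum_sets n.+1 (fun j => star_set (nth I (strong_pows I n.+1) j.-1)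
                    (nth I (strong_pows I n.+1) (n.+2 - j).-1))) by [].
rewrite nth_rcons size_strong_pows ltnn eqxx.
apply: eq_sum_sets => -[//|j] jn.
by rewrite subSS subSn // !nth_strong_pows ?ltnS ?leq_subr.
Qed.

Definition left_nilpotent I := exists n, left_pow I n = [set 0].
Definition right_nilpotent I := exists n, right_pow I n = [set 0].
Definition strongly_nilpotent I := exists n, strong_pow I n = [set 0].

Record is_ideal I : Prop := IsIdeal {
  ideal0 : I 0;
  idealB : forall x y, I x -> I y -> I (x - y);
  ideal_lambda : forall a x, I x -> I (blambda a x);
  ideal_normal : forall a x, I x -> I (x ^ a)%g
}.

Definition prime_brace := forall I J, is_ideal I -> is_ideal J ->
  I <> [set 0] -> J <> [set 0] -> star_set I J <> [set 0].

End BraceTheory.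

Section GroupXV.
Variables (p : nat) (p_pr : prime p) (p_gt3 : (3 < p)%N).
Local Notation F := 'F_p.

(* The group XV, realised by normal forms: [(s, r, q, t)] stands for          *)
(* [S^s R^r Q^q P^t]. The lemma [groupXV_isoGrp] states that this is the      *)
(* group given by the presentation.                                           *)
Definition groupXV of prime p & (3 < p)%N : Type := (F * F * F * F)%type.
Local Notation G := (groupXV p_pr p_gt3).

HB.instance Definition _ := Finite.on G.

Definition XV_mul (g h : G) : G :=
  let: (s, r, q, t) := g in let: (s', r', q', t') := h in
  (s + s', r + r', q + q' + r * s',
   t + t' + q * s' + r * (s' * (s' - 1) / 2)).
Definition XV_one : G := (0, 0, 0, 0).
Definition XV_inv (g : G) : G :=
  let: (s, r, q, t) := g in
  (- s, - r, r * s - q, q * s - t - r * (s * (s + 1) / 2)).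

Lemma XV_pchar : p \in [pchar F].
Proof. exact: pchar_Fp. Qed.

Lemma XV_natr_neq0 n : (0 < n < p)%N -> n%:R != 0 :> F.
Proof. by case/andP=> n0 np; rewrite -(dvdn_pcharf XV_pchar) gtnNdvd. Qed.

Lemma XV_2neq0 : 2 != 0 :> F.
Proof. by apply: XV_natr_neq0; rewrite (ltn_trans _ p_gt3). Qed.
Lemma XV_3neq0 : 3 != 0 :> F.
Proof. exact: XV_natr_neq0. Qed.

Lemma XV_mulA : associative XV_mul.
Proof.
move=> [[[a b] c] d] [[[a' b'] c'] d'] [[[a2 b2] c2] d2] /=.
by congr (_, _, _, _); field; rewrite ?XV_2neq0.
Qed.

Lemma XV_mul1 : left_id XV_one XV_mul.
Proof. by move=> [[[a b] c] d] /=; congr (_, _, _, _); ring. Qed.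

Lemma XV_mulV : left_inverse XV_one XV_inv XV_mul.
Proof.
move=> [[[a b] c] d] /=.
by congr (_, _, _, _); field; rewrite ?XV_2neq0.
Qed.

HB.instance Definition _ := Finite_isGroup.Build G XV_mulA XV_mul1 XV_mulV.

Definition XV_S : G := (1, 0, 0, 0).
Definition XV_R : G := (0, 1, 0, 0).
Definition XV_Q : G := (0, 0, 1, 0).
Definition XV_P : G := (0, 0, 0, 1).

Lemma XV_mulE (g h : G) : (g * h)%g = XV_mul g h.
Proof. by []. Qed.

Lemma card_groupXV : #|{: G}| = (p ^ 4)%N.
Proof. by rewrite !card_prod card_Fp // !expnS expn0 muln1 -!mulnA. Qed.

Lemma natr_val (u : F) : (u : nat)%:R = u.
Proof. exact: natr_Zp. Qed.

Lemma XV_expS n : (XV_S ^+ n)%g = (n%:R, 0, 0, 0) :> G.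
Proof.
elim: n => // n IHn; rewrite expgS IHn XV_mulE /= -natr1.
by congr (_, _, _, _); ring.
Qed.

Lemma XV_expR n : (XV_R ^+ n)%g = (0, n%:R, 0, 0) :> G.
Proof.
elim: n => // n IHn; rewrite expgS IHn XV_mulE /= -natr1.
by congr (_, _, _, _); ring.
Qed.

Lemma XV_expQ n : (XV_Q ^+ n)%g = (0, 0, n%:R, 0) :> G.
Proof.
elim: n => // n IHn; rewrite expgS IHn XV_mulE /= -natr1.
by congr (_, _, _, _); ring.
Qed.

Lemma XV_expP n : (XV_P ^+ n)%g = (0, 0, 0, n%:R) :> G.
Proof.
elim: n => // n IHn; rewrite expgS IHn XV_mulE /= -natr1.
by congr (_, _, _, _); ring.
Qed.

Lemma XV_normal_form (s r q t : F) :
  (XV_S ^+ s * XV_R ^+ r * XV_Q ^+ q * XV_P ^+ t)%g = (s, r, q, t) :> G.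
Proof.
rewrite XV_expS XV_expR XV_expQ XV_expP !natr_val !XV_mulE /=.
by congr (_, _, _, _); ring.
Qed.


Lemma XV_QS : (XV_Q * XV_S = XV_S * XV_Q * XV_P)%g.
Proof. by congr (_, _, _, _); ring. Qed.
Lemma XV_QR : (XV_Q * XV_R = XV_R * XV_Q)%g.
Proof. by congr (_, _, _, _); ring. Qed.
Lemma XV_PS : (XV_P * XV_S = XV_S * XV_P)%g.
Proof. by congr (_, _, _, _); ring. Qed.
Lemma XV_PQ : (XV_P * XV_Q = XV_Q * XV_P)%g.
Proof. by congr (_, _, _, _); ring. Qed.
Lemma XV_PR : (XV_P * XV_R = XV_R * XV_P)%g.
Proof. by congr (_, _, _, _); ring. Qed.
Lemma XV_RS : (XV_R * XV_S = XV_S * XV_R * XV_Q)%g.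
Proof. by congr (_, _, _, _); ring. Qed.
Lemma XV_Pp : (XV_P ^+ p = 1)%g.
Proof. by rewrite XV_expP pchar_Fp_0. Qed.
Lemma XV_Qp : (XV_Q ^+ p = 1)%g.
Proof. by rewrite XV_expQ pchar_Fp_0. Qed.
Lemma XV_Rp : (XV_R ^+ p = 1)%g.
Proof. by rewrite XV_expR pchar_Fp_0. Qed.
Lemma XV_Sp : (XV_S ^+ p = 1)%g.
Proof. by rewrite XV_expS pchar_Fp_0. Qed.

Lemma XV_generated :
  (<[XV_P]> <*> <[XV_Q]> <*> <[XV_R]> <*> <[XV_S]>)%g = [set: G]%SET.
Proof.
apply/eqP; rewrite finset.eqEsubset finset.subsetT /=; apply/fintype.subsetP => -[[[s r] q] t] _.
rewrite -XV_normal_form.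
have sub1 x (X Y : {set G}) : (x \in X -> x \in X <*> Y)%g.
  by move=> Xx; rewrite mem_gen // inE Xx.
have sub2 x (X : {set G}) : (x \in X <*> <[x]>)%g.
  by rewrite mem_gen // inE cycle_id orbT.
rewrite !groupM ?groupX //.
- exact: sub2.
- by apply: sub1; exact: sub2.
- by do 2!apply: (sub1); exact: sub2.
- by do 3!apply: (sub1); exact: cycle_id.
Qed.

Lemma bin2_natr n : ('C(n, 2))%:R = n%:R * (n%:R - 1) / 2 :> F.
Proof.
elim: n => [|n IHn]; first by rewrite mul0r mul0r.
rewrite binS bin1 natrD IHn -natr1; field; exact: XV_2neq0.
Qed.

Lemma XV_exp_mod (rT : finGroupType) (x : rT) n :
  (x ^+ p = 1 -> x ^+ (n%:R : F) = x ^+ n)%g.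
Proof. by move=> xp; rewrite val_Fp_nat // expg_mod. Qed.

Lemma XV_morphism (rT : finGroupType) (P Q R S : rT) :
  (Q * S = S * Q * P)%g -> (Q * R = R * Q)%g -> (P * S = S * P)%g ->
  (P * Q = Q * P)%g -> (P * R = R * P)%g -> (R * S = S * R * Q)%g ->
  (P ^+ p = 1)%g -> (Q ^+ p = 1)%g -> (R ^+ p = 1)%g -> (S ^+ p = 1)%g ->
  {morph (fun g : G => let: (s, r, q, t) := g in
            S ^+ (s : F) * R ^+ (r : F) * Q ^+ (q : F) * P ^+ (t : F))%g
    : g h / (g * h)%g >-> (g * h)%g}.
Proof.
move=> QS QR PS PQ PR RS Pp Qp Rp Sp.
have PSn n : (P ^ (S ^+ n) = P)%g.
  by apply/conjg_fixP/commgP/commuteX.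
have QSn n : (Q ^ (S ^+ n) = Q * P ^+ n)%g.
  elim: n => [|n IHn]; first by rewrite conjg1 mulg1.
  rewrite expgSr conjgM IHn conjMg conjXg (PSn 1%N) conjgE QS -!mulgA mulKg.
  by rewrite expgS.
have RSn n : (R ^ (S ^+ n) = R * Q ^+ n * P ^+ 'C(n, 2))%g.
  elim: n => [|n IHn]; first by rewrite conjg1 !mulg1.
  rewrite expgSr conjgM IHn !conjMg !conjXg (PSn 1%N) (QSn 1%N).
  rewrite {1}conjgE RS expg1 expgMn; last exact: esym.
  by rewrite binS bin1 addnC expgD expgS -!mulgA mulKg !mulgA.
have conjE r q t n : ((R ^+ r * Q ^+ q * P ^+ t) ^ (S ^+ n) =
    R ^+ r * Q ^+ (q + r * n) * P ^+ (t + q * n + r * 'C(n, 2)))%g.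
  have cPP a b : commute (P ^+ a) (P ^+ b) by apply: commuteX2.
  have cPQ a b : commute (P ^+ a) (Q ^+ b) by apply: commuteX2.
  have cPR a b : commute (P ^+ a) (R ^+ b) by apply: commuteX2.
  have cQR a b : commute (Q ^+ a) (R ^+ b) by apply: commuteX2.
  have cQP a : commute Q (P ^+ a)%g by apply/commute_sym/(cPQ a 1%N).
  have cRQ a : commute R (Q ^+ a)%g by apply/commute_sym/(cQR a 1%N).
  have cRQP a b : commute (R * Q ^+ a)%g (P ^+ b)%g.
    by apply/commute_sym/commuteM; [exact: (cPR b 1%N) | exact: cPQ].
  rewrite !conjMg !conjXg PSn QSn RSn (expgMn _ (cQP _)).
  rewrite (expgMn _ (cRQP _ _)) (expgMn _ (cRQ _)).
  rewrite -!expgM (mulnC n r) (mulnC n q) (mulnC 'C(n, 2)) -!mulgA.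
  rewrite (mulgA (P ^+ _)%g (Q ^+ _)%g) cPQ -!mulgA -!expgD.
  rewrite (mulgA (Q ^+ _)%g) -expgD.
  by congr (_ * (_ ^+ _ * _ ^+ _))%g; lia.
have mulE r q t r' q' t' : (R ^+ r * Q ^+ q * P ^+ t * (R ^+ r' * Q ^+ q' * P ^+ t') =
    R ^+ (r + r') * Q ^+ (q + q') * P ^+ (t + t'))%g.
  have cPQ a b : commute (P ^+ a) (Q ^+ b) by apply: commuteX2.
  have cPR a b : commute (P ^+ a) (R ^+ b) by apply: commuteX2.
  have cQR a b : commute (Q ^+ a) (R ^+ b) by apply: commuteX2.
  rewrite !expgD -!mulgA; congr (_ * _)%g.
  rewrite (mulgA (P ^+ _)%g) cPR -!mulgA (mulgA (P ^+ _)%g (Q ^+ _)%g) cPQ.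
  by rewrite -!mulgA (mulgA (Q ^+ _)%g (R ^+ _)%g) cQR -!mulgA.
have natE (u : F) : u = (u : nat)%:R by rewrite natr_val.
move=> [[[s r] q] t] [[[s' r'] q'] t']; rewrite XV_mulE /XV_mul; cbv beta iota.
rewrite (natE s) (natE r) (natE q) (natE t) (natE s') (natE r') (natE q').
rewrite (natE t') -bin2_natr -!natrM -!natrD !XV_exp_mod //.
transitivity (S ^+ s * (R ^+ r * Q ^+ q * P ^+ t * S ^+ s') *
  (R ^+ r' * Q ^+ q' * P ^+ t'))%g; last by rewrite !mulgA.
rewrite (conjgC _ (S ^+ s')%g) conjE -(mulgA (S ^+ s)%g) -(mulgA (S ^+ s')%g).
rewrite mulE expgD -!mulgA.
by congr (_ * (_ * (_ * (_ ^+ _ * _ ^+ _))))%g; lia.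
Qed.

Lemma groupXV_isoGrp :
  ([set: G]%SET \isog Grp (P : Q : R : S :
    Q * S = S * Q * P, Q * R = R * Q, P * S = S * P, P * Q = Q * P,
    P * R = R * P, R * S = S * R * Q, P ^+ p, Q ^+ p, R ^+ p, S ^+ p))%g.
Proof.
apply: intro_isoGrp => [|rT H].
  apply/existsP; exists (XV_P, XV_Q, XV_R, XV_S).
  apply/eqP; rewrite /= XV_generated XV_QS XV_QR XV_PS XV_PQ XV_PR XV_RS.
  by rewrite XV_Pp XV_Qp XV_Rp XV_Sp.
case/existsP=> -[[[P Q] R] S] /= /eqP[defH QS QR PS PQ PR RS Pp Qp Rp Sp].
have phiM := XV_morphism QS QR PS PQ PR RS Pp Qp Rp Sp.
pose phi := Morphism (in2W phiM : {in [set: G]%SET &, _}).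
have phiE s r q t : phi (s, r, q, t) =
    (S ^+ (s : F) * R ^+ (r : F) * Q ^+ (q : F) * P ^+ (t : F))%g by [].
have exp0 (x : rT) : (x ^+ (0%R : F) = 1)%g by [].
have exp1 (x : rT) : (x ^+ p = 1 -> x ^+ (1%R : F) = x)%g.
  by move=> xp; rewrite -[1%R]mulr1n XV_exp_mod.
apply/homgP; exists phi.
transitivity (phi @* (<[XV_P]> <*> <[XV_Q]> <*> <[XV_R]> <*> <[XV_S]>))%g.
  by rewrite XV_generated.
rewrite !morphimY ?finset.subsetT //.
rewrite !morphim_cycle ?in_setT // -defH.
have -> : phi XV_P = P by rewrite /XV_P phiE !exp0 exp1 ?mul1g.
have -> : phi XV_Q = Q by rewrite /XV_Q phiE !exp0 exp1 ?mul1g ?mulg1.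
have -> : phi XV_R = R by rewrite /XV_R phiE !exp0 exp1 ?mul1g ?mulg1.
by have -> : phi XV_S = S by rewrite /XV_S phiE !exp0 exp1 ?mulg1.
Qed.

End GroupXV.

Section LambdaMaps.
Variables (F : fieldType) (i k y : F).
Local Notation B' := 'rV[F]_5.

(* The basis 1, R', Q', P', S' of B', in this order. *)
Definition b1 : B' := delta_mx 0 0.
Definition bR : B' := delta_mx 0 1.
Definition bQ : B' := delta_mx 0 2.
Definition bP : B' := delta_mx 0 3.
Definition bS : B' := delta_mx 0 4.

(* The linear map sending the basis 1, R', Q', P', S' to u1, uR, uQ, uP, uS. *)
Definition linB (u1 uR uQ uP uS v : B') : B' :=
  v 0 0 *: u1 + v 0 1 *: uR + v 0 2 *: uQ + v 0 3 *: uP + v 0 4 *: uS.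

Definition lamP : B' -> B' := linB (bP + b1) (bR + y *: bS) bQ bP bS.
Definition lamQ : B' -> B' :=
  linB (bQ + b1) (bR + (2^-1 * y) *: bS) (bQ - y *: bS) bP bS.
Definition lamR : B' -> B' :=
  linB (bR + b1) (bR + i *: bP + k *: bS) (bQ + (2^-1 * y) *: bS)
       (bP + y *: bS) bS.
Definition lamS : B' -> B' :=
  linB (bS + b1) (bR - bQ + bP - (2^-1 * y) *: bS) (bQ - bP) bP bS.

Definition mkB (a b c d e : F) : B' :=
  a *: b1 + b *: bR + c *: bQ + d *: bP + e *: bS.

Lemma mkBE (a b c d e : F) (j : 'I_5) :
  mkB a b c d e 0 j = nth 0 [:: a; b; c; d; e] j.
Proof.
case: j => -[|[|[|[|[|//]]]]] /= jlt;
  by rewrite !mxE /= ?mulr0 ?mulr1 ?addr0 ?add0r.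
Qed.

Lemma mkBK (v : B') : mkB (v 0 0) (v 0 1) (v 0 2) (v 0 3) (v 0 4) = v.
Proof.
apply/rowP=> j; rewrite mkBE.
by case: j => -[|[|[|[|[|//]]]]] /= jlt; congr (v 0 _); apply/val_inj.
Qed.

Lemma linBE u1 uR uQ uP uS a b c d e :
  linB u1 uR uQ uP uS (mkB a b c d e) =
  a *: u1 + b *: uR + c *: uQ + d *: uP + e *: uS.
Proof. by rewrite /linB !mkBE. Qed.

Lemma linB_linear u1 uR uQ uP uS : linear (linB u1 uR uQ uP uS).
Proof. by move=> a u v; apply/rowP=> j; rewrite !mxE; ring. Qed.

Lemma lamP_mk a b c d e : lamP (mkB a b c d e) = mkB a b c (d + a) (e + y * b).
Proof. by rewrite /lamP linBE; apply/rowP=> j; rewrite !mxE; ring. Qed.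
Lemma lamQ_mk a b c d e :
  lamQ (mkB a b c d e) = mkB a b (c + a) d (e + y / 2 * b - y * c).
Proof. by rewrite /lamQ linBE; apply/rowP=> j; rewrite !mxE; ring. Qed.
Lemma lamR_mk a b c d e : lamR (mkB a b c d e) =
  mkB a (b + a) c (d + i * b) (e + k * b + y / 2 * c + y * d).
Proof. by rewrite /lamR linBE; apply/rowP=> j; rewrite !mxE; ring. Qed.
Lemma lamS_mk a b c d e : lamS (mkB a b c d e) =
  mkB a b (c - b) (d + b - c) (e + a - y / 2 * b).
Proof. by rewrite /lamS linBE; apply/rowP=> j; rewrite !mxE; ring. Qed.

Hypotheses (n2 : 2 != 0 :> F) (n3 : 3 != 0 :> F).

Lemma iter_lamP (n : nat) a b c d e : iter n lamP (mkB a b c d e) =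
  mkB a b c (d + n%:R * a) (e + n%:R * (y * b)).
Proof.
elim: n => [|n IHn]; first by congr mkB; ring.
by rewrite iterS IHn lamP_mk -natr1; congr mkB; ring.
Qed.

Lemma iter_lamQ (n : nat) a b c d e : iter n lamQ (mkB a b c d e) =
  mkB a b (c + n%:R * a) d
    (e + n%:R * (y / 2) * b - y * (n%:R * c + n%:R * (n%:R - 1) / 2 * a)).
Proof.
elim: n => [|n IHn]; first by congr mkB; ring.
by rewrite iterS IHn lamQ_mk -natr1; congr mkB; field; rewrite ?n2.
Qed.

Lemma iter_lamR (n : nat) a b c d e : iter n lamR (mkB a b c d e) =
  mkB a (b + n%:R * a) c (d + i * (n%:R * b + n%:R * (n%:R - 1) / 2 * a))
    (e + k * (n%:R * b + n%:R * (n%:R - 1) / 2 * a) + n%:R * (y / 2) * c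
     + y * (n%:R * d + i * (n%:R * (n%:R - 1) / 2 * b +
            n%:R * (n%:R - 1) * (n%:R - 2) / 2 / 3 * a))).
Proof.
elim: n => [|n IHn]; first by congr mkB; ring.
by rewrite iterS IHn lamR_mk -natr1; congr mkB; field; rewrite ?n2 ?n3.
Qed.

Lemma iter_lamS (n : nat) a b c d e : iter n lamS (mkB a b c d e) =
  mkB a b (c - n%:R * b)
    (d + n%:R * b - n%:R * c + n%:R * (n%:R - 1) / 2 * b)
    (e + n%:R * a - n%:R * (y / 2) * b).
Proof.
elim: n => [|n IHn]; first by congr mkB; ring.
by rewrite iterS IHn lamS_mk -natr1; congr mkB; field; rewrite ?n2.
Qed.

Lemma lam_mul (s r q t s1 r1 q1 t1 s2 r2 q2 t2 : nat) (v : B') :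
  s2%:R = s%:R + s1%:R :> F -> r2%:R = r%:R + r1%:R :> F ->
  q2%:R = q%:R + q1%:R + r%:R * s1%:R :> F ->
  t2%:R = t%:R + t1%:R + q%:R * s1%:R
          + r%:R * (s1%:R * (s1%:R - 1) / 2) :> F ->
  iter s2 lamS (iter r2 lamR (iter q2 lamQ (iter t2 lamP v))) =
  iter s lamS (iter r lamR (iter q lamQ (iter t lamP
    (iter s1 lamS (iter r1 lamR (iter q1 lamQ (iter t1 lamP v))))))).
Proof.
move=> es er eq et; rewrite -(mkBK v).
rewrite !(iter_lamP, iter_lamQ, iter_lamR, iter_lamS) es er eq et.
by congr mkB; field; rewrite ?n2 ?n3.
Qed.

Lemma b1E : b1 = mkB 1 0 0 0 0.
Proof. by rewrite /mkB !scale0r scale1r !addr0. Qed.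

Definition f_coord (s r q t : F) : B' :=
  mkB 0 r (q - s * r)
    (t + r * (r - 1) / 2 * i - s * q + (s + s * (s - 1) / 2) * r)
    (s - q * (q - 1) / 2 * y + r * (r - 1) / 2 * k
     + r * (r - 1) * (r - 2) / 2 / 3 * i * y + t * r * y + q * r / 2 * y
     - s / 2 * y * r).

Definition f_inv (v : B') : F * F * F * F :=
  let r := v 0 1 in let u := v 0 2 in
  let w := v 0 3 - r * (r - 1) / 2 * i in
  let s := v 0 4 - (r * (r - 1) / 2 * k - u * (u - 1) / 2 * y
     + r * (r - 1) * (r - 2) / 2 / 3 * i * y + w * r * y + u * r / 2 * y) in
  let q := u + s * r in
  (s, r, q, w + s * q - (s + s * (s - 1) / 2) * r).

Lemma f_coordE (s r q t : nat) :
  iter s lamS (iter r lamR (iter q lamQ (iter t lamP b1))) - b1 =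
  f_coord s%:R r%:R q%:R t%:R.
Proof.
rewrite b1E !(iter_lamP, iter_lamQ, iter_lamR, iter_lamS).
have mkB_sub a b c d e : mkB a b c d e - mkB 1 0 0 0 0 = mkB (a - 1) b c d e.
  by apply/rowP=> j; rewrite !mxE; ring.
by rewrite mkB_sub; congr mkB; field; rewrite ?n2 ?n3.
Qed.

Lemma f_coordK (s r q t : F) : f_inv (f_coord s r q t) = (s, r, q, t).
Proof.
rewrite /f_inv !mkBE /=.
by congr (_, _, _, _); field; rewrite ?n2 ?n3.
Qed.

Lemma f_invK (v : B') s r q t :
  v 0 0 = 0 -> f_inv v = (s, r, q, t) -> f_coord s r q t = v.
Proof.
move=> v0 [<- <- <- <-]; rewrite -[RHS]mkBK v0.
by congr mkB; field; rewrite ?n2 ?n3.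
Qed.
End LambdaMaps.

Section BraceA.
Variables (p : nat) (p_pr : prime p) (p_gt3 : (3 < p)%N) (i k y : 'F_p).
Local Notation F := 'F_p.
Local Notation G := (groupXV p_pr p_gt3).
Local Notation B' := 'rV[F]_5.

Let n2 := XV_2neq0 p_pr p_gt3.
Let n3 := XV_3neq0 p_pr p_gt3.

(* The composite of powers given by the normal form of [g]. The lemmas        *)
(* [lam_XV_P], [lam_XV_Q], [lam_XV_R], [lam_XV_S] and [lamM] characterise it   *)
(* as the homomorphism extending the four maps above to the group XV.         *)
Definition lam (g : G) : B' -> B' :=
  let: (s, r, q, t) := g in
  iter (s : F) (lamS y) \o iter (r : F) (lamR i k y) \o
  iter (q : F) (lamQ y) \o iter (t : F) (lamP y).

Lemma val_F1 : (1%R : F) = 1%N :> nat.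
Proof. by rewrite -[1%R]mulr1n val_Fp_nat // modn_small // prime_gt1. Qed.

Lemma lam_XV_P : lam (XV_P _ _) = lamP y.
Proof. by rewrite /lam /XV_P val_F1. Qed.
Lemma lam_XV_Q : lam (XV_Q _ _) = lamQ y.
Proof. by rewrite /lam /XV_Q val_F1. Qed.
Lemma lam_XV_R : lam (XV_R _ _) = lamR i k y.
Proof. by rewrite /lam /XV_R val_F1. Qed.
Lemma lam_XV_S : lam (XV_S _ _) = lamS y.
Proof. by rewrite /lam /XV_S val_F1. Qed.

Lemma lamM g h v : lam (g * h)%g v = lam g (lam h v).
Proof.
move: g h => [[[s r] q] t] [[[s' r'] q'] t'].
rewrite XV_mulE /XV_mul; cbv beta iota.
by apply: lam_mul; rewrite // !natr_val.
Qed.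

Lemma lam1 v : lam 1%g v = v.
Proof. by []. Qed.

Lemma lam_linear g : linear (lam g).
Proof.
have lin_iter (h : B' -> B') n : linear h -> linear (iter n h).
  by move=> lin_h; elim: n => [|n IHn] a u v //; rewrite !iterS IHn lin_h.
case: g => [[[s r] q] t] a u v; rewrite /lam /=.
by rewrite (lin_iter _ t) ?(lin_iter _ q) ?(lin_iter _ r) ?(lin_iter _ s);
  do ?exact: linB_linear.
Qed.

Definition fB (g : G) : B' := lam g (b1 F) - b1 F.

Lemma fBE s r q t : fB (s, r, q, t) = f_coord i k y s r q t.
Proof. by rewrite [LHS](f_coordE i k y n2 n3) !natr_val. Qed.

Lemma fB_inj : injective fB.
Proof.
move=> [[[s r] q] t] [[[s' r'] q'] t'] /(congr1 (f_inv i k y)).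
by rewrite !fBE !f_coordK.
Qed.

(* B is the hyperplane of B' spanned by R', Q', P', S'. *)
Lemma fB_codom (v : B') : (v \in codom fB) = (v 0 0 == 0).
Proof.
apply/codomP/eqP=> [[[[[s r] q] t] ->]|v0]; first by rewrite fBE mkBE.
case vE: (f_inv i k y v) => [[[s r] q] t].
by exists ((s, r, q, t) : G); rewrite fBE (f_invK n2 n3 v0 vE).
Qed.

(* The inverse of the bijection [fB] from G to B (and 1 outside B). *)
Definition fB_inv (v : B') : G := odflt 1%g [pick g | fB g == v].

Lemma fBK : cancel fB fB_inv.
Proof.
move=> g; rewrite /fB_inv; case: pickP => [h /eqP/fB_inj //|/(_ g)].
by rewrite eqxx.
Qed.

Lemma fB_invK (v : B') : v 0 0 = 0 -> fB (fB_inv v) = v.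
Proof. by move/eqP; rewrite -fB_codom => /codomP[g ->]; rewrite fBK. Qed.

Definition braceXV of F & F & F : Type := G.
Local Notation A := (braceXV i k y).

HB.instance Definition _ := FinGroup.on A.

Definition XV_add (g h : A) : A := fB_inv (fB g + fB h).
Definition XV_zero : A := 1%g.
Definition XV_opp (g : A) : A := fB_inv (- fB g).

Lemma fB0 g : fB g 0 0 = 0.
Proof. by apply/eqP; rewrite -fB_codom codom_f. Qed.

Lemma fB_add g h : fB (XV_add g h) = fB g + fB h.
Proof. by rewrite fB_invK // mxE !fB0 addr0. Qed.

Lemma fB_zero : fB XV_zero = 0.
Proof. by rewrite /fB lam1 subrr. Qed.

Lemma XV_addA : associative XV_add.
Proof. by move=> g h l; apply: fB_inj; rewrite !fB_add addrA. Qed.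

Lemma XV_addC : commutative XV_add.
Proof. by move=> g h; apply: fB_inj; rewrite !fB_add addrC. Qed.

Lemma XV_add0 : left_id XV_zero XV_add.
Proof. by move=> g; apply: fB_inj; rewrite fB_add fB_zero add0r. Qed.

Lemma XV_addN : left_inverse XV_zero XV_opp XV_add.
Proof.
move=> g; apply: fB_inj; rewrite fB_add fB_zero fB_invK ?addNr //.
by rewrite mxE fB0 oppr0.
Qed.

HB.instance Definition _ := GRing.isZmodule.Build A
  XV_addA XV_addC XV_add0 XV_addN.

Lemma fBD (g h : A) : fB (g + h) = fB g + fB h.
Proof. exact: fB_add. Qed.

Lemma fBM (g h : A) : fB (g * h)%g = lam g (fB h) + fB g.
Proof.
have lamB u v : lam g (u - v) = lam g u - lam g v.
  by rewrite addrC -scaleN1r lam_linear scaleN1r addrC.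
by rewrite /fB lamM lamB addrA subrK.
Qed.

Lemma XV_brace_distr (g h l : A) :
  (g * (h + l))%g + g = (g * h)%g + (g * l)%g.
Proof.
apply: fB_inj; rewrite !fBD !fBM fBD -[fB h]scale1r lam_linear !scale1r.
move: (lam g (fB h)) (lam g (fB l)) (fB g) => u v w.
by rewrite -!addrA; congr (_ + _); exact: addrCA.
Qed.

HB.instance Definition _ := isBrace.Build A XV_brace_distr.
End BraceA.

(* Main.v *)
Require Import Defs.
From mathcomp Require Import all_boot all_algebra.
From mathcomp Require Import classical_sets.
From mathcomp Require Import boolp ring.
Import GRing.Theory.
Local Open Scope classical_set_scope.
Local Open Scope ring_scope.

(** The bijection [fB] turns the brace into the space B with basis
    R', Q', P', S', where [star g] is the operator [lam g - 1]
    ([fB_star]). Everything is read off from these operators.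

    Primeness. On a vector of B with a non-zero coordinate outside S', one of
    the operators of P, Q, R has value a non-zero multiple of S', because y is
    invertible. Hence a non-zero ideal contains S^e for some e != 0
    ([ideal_contains_XV_S]), and also the conjugate of S^e by R, whose exponents
    on S, R and Q are e, 0 and -e ([ideal_contains_conj]). For g and h with
    trivial R-exponent, the P'-coordinate of [star g h] is minus the product of
    the S-exponent of g and the Q-exponent of h ([fB_star_layer1]). So two such
    conjugates, one in each of two non-zero ideals, have a non-zero product.

    The ideal. The R'-coordinate is a homomorphism for both operations
    ([fB_mul_R]) and its kernel, the span of Q', P', S', is A^2
    ([square_kernel]). Giving Q', S', P' the weights 1, 2, 3 yields a
    filtration of that kernel with [L_m * L_n] inside [L_(m + n)]
    ([star_layer]) which vanishes from weight 4 on. Any brace ideal with such a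
    filtration is left, right and strongly nilpotent, as each of its n-th
    powers lies in [L_n]. *)

(** * Ideals and filtrations of a brace *)

Section Filtration.
Variable A : braceType.
Implicit Types (I X Y Z : set A).

Lemma ideal_star I (a x : A) : is_ideal I -> I x -> I (star a x).
Proof.
move=> idI Ix; rewrite -[star a x](addrK x).
by apply: idealB => //; exact: ideal_lambda.
Qed.

Lemma ideal_neq0 I : is_ideal I -> I <> [set 0] -> exists2 x, I x & x <> 0.
Proof.
move=> idI I0; apply: contrapT => noI; apply: I0; apply/seteqP; split=> x.
  by move=> Ix; apply: contrapT => x0; apply: noI; exists x.
by move=> ->; exact: ideal0.
Qed.

Lemma star_set_sub X Y Z : Z 0 -> (forall x y, Z x -> Z y -> Z (x + y)) ->
  (forall x y, X x -> Y y -> Z (star x y)) -> star_set X Y `<=` Z.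
Proof.
move=> Z0 ZD ZXY _ [s XYs ->]; elim: s XYs => [|u s IHs] XYs.
  by rewrite big_nil.
rewrite big_cons; apply: (ZD) => [|].
  by have [Xu Yu] := XYs u (mem_head _ _); exact: ZXY.
by apply: IHs => v sv; apply: XYs; rewrite inE sv orbT.
Qed.

Lemma star_set0 X Y : star_set X Y 0.
Proof. by exists [::] => //; rewrite big_nil. Qed.

Lemma star_setD X Y a b :
  star_set X Y a -> star_set X Y b -> star_set X Y (a + b).
Proof.
move=> [s XYs ->] [t XYt ->]; exists (s ++ t); last by rewrite big_cat.
by move=> u; rewrite mem_cat => /orP[/XYs|/XYt].
Qed.

Lemma star_set1 X Y x y : X x -> Y y -> star_set X Y (star x y).
Proof.
move=> Xx Yy; exists [:: (x, y)]; last by rewrite big_seq1.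
by move=> u; rewrite inE => /eqP->.
Qed.

Section NilpotentFiltration.
Variables (I : set A) (L : nat -> set A) (N : nat).
Hypotheses (L0 : forall n, L n 0)
  (LD : forall n x y, L n x -> L n y -> L n (x + y))
  (Lstar : forall m n x y, L m.+1 x -> L n.+1 y -> L (m.+1 + n.+1)%N (star x y)).
Hypotheses (I0 : I 0) (IL : I `<=` L 1%N) (LN : L N.+1 `<=` [set 0]).

(** The hypothesis [Lstar] is additive in the weights, so every way of
    bracketing n factors from [I] ends in [L n]; the three kinds of powers
    differ only in the bracketings that they allow. *)
Lemma left_pow_sub n : left_pow I n.+1 `<=` L n.+1.
Proof.
elim: n => [//|n IHn]; apply: star_set_sub => // [x y|x y Ix Iy].
  exact: LD.
by apply: (Lstar 0%N n); [exact: IL | exact: IHn].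
Qed.

Lemma right_pow_sub n : right_pow I n.+1 `<=` L n.+1.
Proof.
elim: n => [//|n IHn]; apply: star_set_sub => // [x y|x y Ix Iy].
  exact: LD.
by rewrite -[n.+2]addn1; apply: (Lstar n 0%N); [exact: IHn | exact: IL].
Qed.

Lemma strong_pow_sub n : strong_pow I n.+1 `<=` L n.+1.
Proof.
elim/ltn_ind: n => -[|n] IHn; first exact: IL.
rewrite strong_powS // => _ [x Xx ->].
rewrite big_seq; elim/big_ind: _ => [//|u v|j]; first exact: LD.
rewrite mem_index_iota ltnS => jn; move: (Xx j jn).
case: j jn => [//|j]; rewrite ltnS => /= jn; rewrite subSS.
apply: star_set_sub => // [u v|u v]; first exact: LD.
move=> /(IHn _ _)-/(_ jn) Lu; rewrite subSn // => /(IHn _ _) Lv.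
have -> : n.+2 = (j.+1 + (n - j).+1)%N by rewrite addSn addnS subnKC.
by apply: Lstar => //; apply: Lv; rewrite ltnS leq_subr.
Qed.

Let eq0_pow (X : set A) : X 0 -> X `<=` L N.+1 -> X = [set 0].
Proof.
move=> X0 XL; apply/seteqP; split=> [x /XL/LN // | x ->//].
Qed.

Lemma filtered_left_nilpotent : left_nilpotent I.
Proof.
exists N.+1; apply: eq0_pow; last exact: left_pow_sub.
by rewrite /left_pow; case: N => [//|n]; exact: star_set0.
Qed.

Lemma filtered_right_nilpotent : right_nilpotent I.
Proof.
exists N.+1; apply: eq0_pow; last exact: right_pow_sub.
by rewrite /right_pow; case: N => [//|n]; exact: star_set0.
Qed.

Lemma filtered_strongly_nilpotent : strongly_nilpotent I.
Proof.
exists N.+1; apply: eq0_pow; last exact: strong_pow_sub.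
case: N => [//|n]; rewrite strong_powS //; exists (fun=> 0).
  by move=> j _; exact: star_set0.
by rewrite big1.
Qed.
End NilpotentFiltration.
End Filtration.

(** * The operators [lam g - 1] in coordinates *)

Section Coordinates.
Variable F : fieldType.
Implicit Types a b c d e : F.

Lemma mkB_sub a b c d e a' b' c' d' e' :
  mkB a b c d e - mkB a' b' c' d' e' =
  mkB (a - a') (b - b') (c - c') (d - d') (e - e').
Proof. by apply/rowP=> j; rewrite !mxE; ring. Qed.

Lemma mkB_add a b c d e a' b' c' d' e' :
  mkB a b c d e + mkB a' b' c' d' e' =
  mkB (a + a') (b + b') (c + c') (d + d') (e + e').
Proof. by apply/rowP=> j; rewrite !mxE; ring. Qed.

Lemma eq_mkB a b c d e a' b' c' d' e' :
  a = a' -> b = b' -> c = c' -> d = d' -> e = e' ->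
  mkB a b c d e = mkB a' b' c' d' e'.
Proof. by do 5!move=> ->. Qed.

Lemma mkB0 : mkB 0 0 0 0 0 = 0 :> 'rV[F]_5.
Proof. by apply/rowP=> j; rewrite !mxE; ring. Qed.

Lemma iter_lam_sub_layer1 (i k y : F) (s r q t : nat) c d e :
  2 != 0 :> F -> 3 != 0 :> F -> r%:R = 0 :> F ->
  iter s (lamS y) (iter r (lamR i k y) (iter q (lamQ y) (iter t (lamP y)
    (mkB 0 0 c d e)))) - mkB 0 0 c d e =
  mkB 0 0 0 (- (s%:R * c)) (- (y * q%:R * c)).
Proof.
move=> n2 n3 r0; rewrite iter_lamP iter_lamQ // iter_lamR // iter_lamS //.
rewrite r0 !(mul0r, mulr0) !(addr0, subr0) mkB_sub.
by apply: eq_mkB; ring.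
Qed.

Lemma iter_lam_R (i k y : F) (s r q t : nat) b c d e :
  2 != 0 :> F -> 3 != 0 :> F ->
  iter s (lamS y) (iter r (lamR i k y) (iter q (lamQ y) (iter t (lamP y)
    (mkB 0 b c d e)))) 0 1 = b.
Proof.
move=> n2 n3; rewrite iter_lamP iter_lamQ // iter_lamR // iter_lamS //.
by rewrite mkBE /= mulr0 addr0.
Qed.
End Coordinates.

Section BraceXV.
Variables (p : nat) (p_pr : prime p) (p_gt3 : (3 < p)%N) (i k y : 'F_p).
Local Notation F := 'F_p.
Local Notation G := (groupXV p_pr p_gt3).
Local Notation A := (braceXV p_pr p_gt3 i k y).
Local Notation f := (@fB p p_pr p_gt3 i k y).
Local Notation lamA := (@lam p p_pr p_gt3 i k y).

Let n2 := XV_2neq0 p_pr p_gt3.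
Let n3 := XV_3neq0 p_pr p_gt3.

Lemma fB_sub (a b : A) : f (a - b) = f a - f b.
Proof. by apply: (addIr (f b)); rewrite -fBD !subrK. Qed.

Lemma fB_star (a b : A) : f (star a b) = lamA a (f b) - f b.
Proof. by rewrite !fB_sub fBM addrK. Qed.

Lemma fB_mkB (a : A) : f a = mkB 0 (f a 0 1) (f a 0 2) (f a 0 3) (f a 0 4).
Proof. by rewrite -[LHS]mkBK fB0. Qed.

Lemma lam_mkB_R (g : G) b c d e : lamA g (mkB 0 b c d e) 0 1 = b.
Proof.
by case: g => [[[s r] q] t]; exact: iter_lam_R _ i k y s r q t b c d e n2 n3.
Qed.

Lemma lam_fB_R (g : G) (a : A) : lamA g (f a) 0 1 = f a 0 1.
Proof. by rewrite fB_mkB lam_mkB_R mkBE. Qed.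

Lemma fB_mul_R (a b : A) : f (a * b)%g 0 1 = f a 0 1 + f b 0 1.
Proof. by rewrite fBM mxE lam_fB_R addrC. Qed.

(** On the kernel of the R'-coordinate the product is additive in the
    exponents of each factor. It sees only the exponents of S and Q on the left
    and the exponent of Q on the right, which gives both the nilpotency of the
    kernel and the non-vanishing needed for primeness. *)
Lemma fB_star_layer1 s q t s' q' t' :
  f (star ((s, 0, q, t) : A) ((s', 0, q', t') : A)) =
  mkB 0 0 0 (- (s * q')) (- (y * q * q')).
Proof.
rewrite fB_star fBE /f_coord /lam mulr0 subr0.
rewrite [LHS](iter_lam_sub_layer1 _ i k y s 0%N q t _ _ _ n2 n3 (erefl _)).
by rewrite !natr_val.
Qed.

(** * The filtration of A^2 *)

(** The list gives the weights in the order 1, R', Q', P', S' of the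
    coordinates. The weights 2 of S' and 3 of P' are forced by the nonzero
    products of Q with Q' (a multiple of S') and of S with Q' (minus P'). *)
Definition layer n : set A := [set a : A |
  forall j : 'I_5, (nth 0%N [:: 0; 0; 1; 3; 2]%N j < n)%N -> f a 0 j = 0].

Lemma layer0 n : layer n 0.
Proof. by move=> j _; rewrite fB_zero mxE. Qed.

Lemma layerD n (a b : A) : layer n a -> layer n b -> layer n (a + b).
Proof. by move=> La Lb j jn; rewrite fBD mxE La // Lb // addr0. Qed.

Lemma layer4 : layer 4 `<=` [set 0].
Proof.
move=> a La; apply: (@fB_inj p p_pr p_gt3 i k y); rewrite fB_zero.
apply/rowP=> j; rewrite La ?mxE //.
by case: j => -[|[|[|[|[|]]]]].
Qed.

(** Only the P' and S' coordinates of a product can be non-zero, and each of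
    them has a factor that vanishes once the weights of the two arguments add
    up to more than its own weight. *)
Lemma star_layer m n (a b : A) :
  layer m.+1 a -> layer n.+1 b -> layer (m.+1 + n.+1) (star a b).
Proof.
case: a b => [[[s r] q] t] [[[s' r'] q'] t'] La Lb.
have r0 : r = 0 by have := La 1 isT; rewrite fBE mkBE.
have r'0 : r' = 0 by have := Lb 1 isT; rewrite fBE mkBE.
rewrite {}r0 {}r'0 in La Lb *.
have q'0 : (0 < n)%N -> q' = 0.
  by move=> n0; have := Lb 2 n0; rewrite fBE mkBE /= mulr0 subr0.
have q0 : (0 < m)%N -> q = 0.
  by move=> m0; have := La 2 m0; rewrite fBE mkBE /= mulr0 subr0.
have s0 : (1 < m)%N -> s = 0.
  move=> m1; have := La 4 m1; rewrite fBE mkBE /= (q0 (ltnW m1)) => e.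
  by rewrite -[RHS]e; ring.
move=> j jmn; rewrite fB_star_layer1 mkBE.
case: j jmn => -[|[|[|[|[|//]]]]] //= _.
  (* P' has weight 3, so either b lies in layer 2 or a in layer 3. *)
  case: n Lb q'0 => [_ _|n _ -> //]; last by rewrite mulr0 oppr0.
  by rewrite addn1 !ltnS => /s0->; rewrite mul0r oppr0.
(* S' has weight 2, so one of a, b lies in layer 2. *)
case: n Lb q'0 => [_ _|n _ -> //]; last by rewrite mulr0 oppr0.
by rewrite addn1 !ltnS => /q0->; rewrite mulr0 mul0r oppr0.
Qed.

(** * The ideal A^2 and primeness *)

Lemma star_XV_P (a : A) :
  f (star (XV_P p_pr p_gt3 : A) a) = mkB 0 0 0 0 (y * f a 0 1).
Proof.
rewrite fB_star lam_XV_P fB_mkB lamP_mk mkBE /= mkB_sub.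
by apply: eq_mkB; ring.
Qed.

Lemma star_XV_Q (a : A) : f (star (XV_Q p_pr p_gt3 : A) a) =
  mkB 0 0 0 0 (y / 2 * f a 0 1 - y * f a 0 2).
Proof.
rewrite fB_star lam_XV_Q fB_mkB lamQ_mk !mkBE /= mkB_sub.
by apply: eq_mkB; ring.
Qed.

Lemma star_XV_R (a : A) : f (star (XV_R p_pr p_gt3 : A) a) =
  mkB 0 0 0 (i * f a 0 1) (k * f a 0 1 + y / 2 * f a 0 2 + y * f a 0 3).
Proof.
rewrite fB_star lam_XV_R fB_mkB lamR_mk !mkBE /= mkB_sub.
by apply: eq_mkB; ring.
Qed.

Lemma star_XV_S (a : A) : f (star (XV_S p_pr p_gt3 : A) a) =
  mkB 0 0 (- f a 0 1) (f a 0 1 - f a 0 2) (- (y / 2 * f a 0 1)).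
Proof.
rewrite fB_star lam_XV_S fB_mkB lamS_mk !mkBE /= mkB_sub.
by apply: eq_mkB; ring.
Qed.

Hypothesis y_neq0 : y != 0.

(** No operator changes the R'-coordinate of a vector of B, so products lie in
    the kernel. Conversely the products with S and P on the left span it; this
    is where S' is reached, as y is invertible. *)
Lemma square_kernel : star_set [set: A] [set: A] = [set a : A | f a 0 1 = 0].
Proof.
apply/seteqP; split=> [|a /= aR].
  apply: star_set_sub => [|a b /= aR bR|a b _ _] /=.
  - by rewrite fB_zero mxE.
  - by rewrite fBD mxE aR bR addr0.
  - by rewrite fB_star mxE [X in _ + X]mxE lam_fB_R subrr.
pose vec (b c : F) : A := @fB_inv p p_pr p_gt3 i k y (mkB 0 b c 0 0).
have fvec b c : f (vec b c) = mkB 0 b c 0 0 by rewrite fB_invK ?mkBE.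
(* The image of S on R' covers Q', then its image on Q' corrects P', and the
   image of P on R' corrects S'. *)
have := fB_mkB a; rewrite aR.
move: (f a 0 2) (f a 0 3) (f a 0 4) => c d e fa.
have imS b q : exists2 u : A, star_set [set: A] [set: A] u &
    f u = mkB 0 0 (- b) (b - q) (- (y / 2 * b)).
  exists (star (XV_S p_pr p_gt3 : A) (vec b q)); first exact: star_set1.
  by rewrite star_XV_S fvec !mkBE.
have imP b : exists2 u : A, star_set [set: A] [set: A] u &
    f u = mkB 0 0 0 0 (y * b).
  exists (star (XV_P p_pr p_gt3 : A) (vec b 0)); first exact: star_set1.
  by rewrite star_XV_P fvec !mkBE.
have [u Au fu] := imS (- c) 0; have [v Av fv] := imS 0 (- c - d).
have [w Aw fw] := imP ((e - y / 2 * c) / y).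
rewrite [a](_ : _ = u + v + w); first by do 2!apply: star_setD => //.
apply: (@fB_inj p p_pr p_gt3 i k y).
rewrite (fBD (u + v) w) (fBD u v) fu fv fw fa.
rewrite [X in X + _]mkB_add [RHS]mkB_add.
by apply: eq_mkB; field; rewrite ?y_neq0 ?n2.
Qed.

Lemma square_ideal : is_ideal (star_set [set: A] [set: A]).
Proof.
rewrite square_kernel; split=> [|a b /= aR bR|a x /= xR|a x /= xR].
- by rewrite /= fB_zero mxE.
- by rewrite /= fB_sub mxE [X in _ + X]mxE aR bR subr0.
- by rewrite /blambda fBD fB_star subrK lam_fB_R.
- rewrite conjgE !fB_mul_R xR add0r -fB_mul_R mulVg.
  by rewrite [f _]fB_zero mxE.
Qed.

(** The operators of P, Q, R isolate in turn the coordinates along R', Q', P'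
    and send them to S'. *)
Lemma ideal_contains_XV_S (I : set A) : is_ideal I -> I <> [set 0] ->
  exists2 e : F, e != 0 & I ((e, 0, 0, 0) : G).
Proof.
move=> idI /(ideal_neq0 _ _ idI)[x Ix x0].
suff [e e0 [a Ia fa]] : exists2 e, e != 0 & exists2 a, I a & f a = mkB 0 0 0 0 e.
  exists e => //; rewrite -[X in I X](_ : a = _) //.
  apply: (@fB_inj p p_pr p_gt3 i k y); rewrite fa fBE.
  by apply: eq_mkB; ring.
have [xR|xR] := eqVneq (f x 0 1) 0; last first.
  exists (y * f x 0 1); first by rewrite mulf_neq0.
  by exists (star (XV_P p_pr p_gt3 : A) x);
    [exact: ideal_star | exact: star_XV_P].
have [xQ|xQ] := eqVneq (f x 0 2) 0; last first.
  exists (- (y * f x 0 2)); first by rewrite oppr_eq0 mulf_neq0.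
  exists (star (XV_Q p_pr p_gt3 : A) x); first exact: ideal_star.
  by rewrite star_XV_Q xR mulr0 add0r.
have [xP|xP] := eqVneq (f x 0 3) 0; last first.
  exists (y * f x 0 3); first by rewrite mulf_neq0.
  exists (star (XV_R p_pr p_gt3 : A) x); first exact: ideal_star.
  by rewrite star_XV_R xR xQ !mulr0 !add0r.
have fx : f x = mkB 0 0 0 0 (f x 0 4) by rewrite [LHS]fB_mkB xR xQ xP.
exists (f x 0 4); last by exists x.
apply/eqP=> xS; apply: x0; apply: (@fB_inj p p_pr p_gt3 i k y).
by rewrite fx xS fB_zero mkB0.
Qed.

(** S^e itself would not do for primeness: its products with S^e' are zero.
    Conjugation by R, through the relation R S = S R Q, brings in a power
    of Q. *)
Lemma ideal_contains_conj (I : set A) : is_ideal I -> I <> [set 0] ->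
  exists2 e : F, e != 0 & exists t, I ((e, 0, - e, t) : G).
Proof.
move=> idI /(ideal_contains_XV_S _ idI)[e e0 Ie]; exists e => //.
exists (- (e * (e - 1) / 2)).
have := ideal_normal idI (XV_R p_pr p_gt3 : A) Ie.
rewrite -[X in I X -> _](_ : ((e, 0, - e, - (e * (e - 1) / 2)) : G) = _) //.
rewrite conjgE /= [RHS]XV_mulE.
by congr (_, _, _, _); field; rewrite ?n2.
Qed.

Lemma braceXV_prime : prime_brace A.
Proof.
move=> I J idI idJ /(ideal_contains_conj _ idI)[e e0 [t Ie]].
move=> /(ideal_contains_conj _ idJ)[e' e'0 [t' Je']] IJ0.
have := star_set1 _ I J ((e, 0, - e, t) : A) ((e', 0, - e', t') : A) Ie Je'.
rewrite IJ0 => /= /(congr1 f).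
rewrite fB_star_layer1 fB_zero => /rowP.
(* Column 3 is the P'-coordinate, which is e * e'. *)
move/(_ 3); rewrite mkBE mxE /= => /eqP.
by rewrite mulrN opprK mulf_eq0 (negbTE e0) (negbTE e'0).
Qed.

Lemma square_neq0 : star_set [set: A] [set: A] <> [set 0].
Proof.
move=> A2; have : star_set [set: A] [set: A] (XV_S p_pr p_gt3).
  by rewrite square_kernel /= fBE mkBE.
by rewrite A2 => /(congr1 (fun g : G => g.1.1.1))/eqP; rewrite oner_eq0.
Qed.

Lemma square_layer1 : star_set [set: A] [set: A] `<=` layer 1.
Proof.
rewrite square_kernel => a /= aR j.
case: j => -[|[|[|[|[|//]]]]] //= j5 _; last first.
  by rewrite -aR; congr (f a 0 _); apply: val_inj.
by rewrite -[RHS](fB0 i k y a); congr (f a 0 _); apply: val_inj.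
Qed.
End BraceXV.

Theorem proposition7p1 (p : nat) (p_pr : prime p) (p_gt3 : (3 < p)%N)
    (i k y : 'F_p) (y_neq0 : y != 0) :
  let A : braceType := braceXV p_pr p_gt3 i k y in
  let A2 : set A := left_pow setT 2 in
  prime_brace A /\
  [/\ is_ideal A2, A2 <> [set 0], strongly_nilpotent A2,
      right_nilpotent A2 & left_nilpotent A2].
Proof.
move=> A A2; split; first exact: braceXV_prime.
have L0 := @layer0 _ p_pr p_gt3 i k y.
have LD := @layerD _ p_pr p_gt3 i k y.
have Lstar := @star_layer _ p_pr p_gt3 i k y.
have L4 := @layer4 _ p_pr p_gt3 i k y.
have A2L : A2 `<=` layer p p_pr p_gt3 i k y 1 by exact: square_layer1.
have A20 : A2 0 by exact: star_set0.
split.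
- exact: square_ideal.
- exact: square_neq0.
- exact: (filtered_strongly_nilpotent A _ _ 3 L0 LD Lstar A20 A2L L4).
- exact: (filtered_right_nilpotent A _ _ 3 L0 LD Lstar A20 A2L L4).
- exact: (filtered_left_nilpotent A _ _ 3 L0 LD Lstar A20 A2L L4).
Qed.
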